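(* Let $\{V_{m,j}\}$ be the $[0,1]$-valued random variables driving a quantile pyramid, and let $Q_m$, $m\ge 1$, be the associated level-$m$ piecewise linear random quantile functions on $[0,1]$. Assume that $$\Delta_m=\max_{1\le j\le 2^m}\{Q_m(j/2^m)-Q_m((j-1)/2^m)\}\to 0\quad\text{in probability as } m\to\infty.$$ Then there is a well-defined random continuous quantile process $Q=\{Q(y):0\le y\le 1\}$ to which $Q_m$ converges in distribution as $m\to\infty$, in the space $C[0,1]$ of continuous functions on the unit interval equipped with the uniform topology.
   Context: Quantile pyramid: for each $m\ge1$ and $j\in\{1,3,5,\dots,2^m-1\}$ let $V_{m,j}$ be a $[0,1]$-valued random variable. For each $m$, the variables $V_{m,j}$ ($j$ odd) are conditionally independent given all variables $V_{m',j'}$ with $m'\le m-1$ from earlier levels (they are allowed to depend on these); apart from this their distributions are arbitrary. Start from the endpoint values $0$ at $y=0$ and $1$ at $y=1$. Recursively, at level $m$, $Q_m$ agrees with $Q_{m-1}$ at the points $i/2^{m-1}$, $0\le i\le 2^{m-1}$ (where for $m=1$ this means $Q_1(0)=0$, $Q_1(1)=1$, i.e. one takes the level-$0$ function to be the identity), and for odd $j$ $$Q_m(j/2^m)=Q_{m-1}((j-1)/2^m)(1-V_{m,j})+Q_{m-1}((j+1)/2^m)V_{m,j}.$$ $Q_m$ is extended to all of $[0,1]$ by linear interpolation between the points $j/2^m$, $0\le j\le 2^m$; in particular $Q_m(0)=0$ and $Q_m(1)=1$. A (random) quantile process on $[0,1]$ is a random nondecreasing function $Q$ with $Q(0)=0$,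 $Q(1)=1$. *)

(* Defs.v *)
From HB Require Import structures.
From mathcomp Require Import all_boot all_order all_algebra.
From mathcomp Require Import all_classical all_reals all_analysis.
From mathcomp Require Import measurable_realfun ring lra.

Set Implicit Arguments.
Unset Strict Implicit.
Unset Printing Implicit Defensive.

Import Order.TTheory GRing.Theory Num.Theory.
Import numFieldNormedType.Exports.

Local Open Scope classical_set_scope.
Local Open Scope ring_scope.

Definition unit_interval (R : realType) : Type := set_type `[0 : R, 1]%classic.
HB.instance Definition _ (R : realType) := PseudoMetric.on (unit_interval R).

Definition C01 (R : realType) : Type := continuousType (unit_interval R) R.
HB.instance Definition _ (R : realType) := Choice.on (C01 R).
HB.instance Definition _ (R : realType) := isPointed.Build (C01 R) (cst 0).

(* [arrow_uniform_type] carries the topology of uniform convergence, so that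
   the topology induced on [C01 R] is that of the sup-distance. *)
Definition C01_fun (R : realType) (f : C01 R) :
  arrow_uniform_type (unit_interval R) R := f : unit_interval R -> R.
HB.instance Definition _ (R : realType) :=
  PseudoMetric.copy (C01 R) (initial_topology (@C01_fun R)).

(* the Borel sigma-algebra of the uniform topology *)
HB.instance Definition _ (R : realType) :=
  Measurable.copy (C01 R) (g_sigma_algebraType (@open (C01 R))).

Lemma C01_ballE (R : realType) (f g : C01 R) (e : R) :
  ball f e g <-> forall y : unit_interval R, `|f y - g y| < e.
Proof. by []. Qed.

Definition quantile_function (R : realType) (f : C01 R) : Prop :=
  [/\ forall y : unit_interval R, \val y = 0 -> f y = 0,
      forall y : unit_interval R, \val y = 1 -> f y = 1 &
      forall y z : unit_interval R, \val y <= \val z -> f y <= f z].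

(* Linear interpolation on [0, 1] of the values g 0, ..., g N at the points
   j / N. At y = 1 the irrelevant value g N.+1 gets weight 0. *)
Definition lin_interp (R : realType) (N : nat) (g : nat -> R) (y : R) : R :=
  let t := y * N%:R in
  let j := Num.truncn t in
  g j + (t - j%:R) * (g j.+1 - g j).

(* The pyramid driven by an array v of numbers; only the v m j with 0 < m, j odd
   and j < 2 ^ m matter. *)
Fixpoint pyramid (R : realType) (v : nat -> nat -> R) (m : nat) (y : R) : R :=
  if m is m'.+1 then
    lin_interp (2 ^ m)
      (fun j =>
         if odd j then
           pyramid v m' (j.-1%:R / (2 ^ m)%:R) * (1 - v m j)
           + pyramid v m' (j.+1%:R / (2 ^ m)%:R) * v m j
         else pyramid v m' (j%:R / (2 ^ m)%:R)) y
  else y.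

Lemma lin_interp_node (R : realType) (N : nat) (g : nat -> R) (j : nat) :
  (0 < N)%N -> lin_interp N g (j%:R / N%:R) = g j.
Proof.
move=> N0; rewrite /lin_interp divfK ?pnatr_eq0 -?lt0n//.
by rewrite natrK subrr mul0r addr0.
Qed.

Section lin_interp_theory.
Variables (R : realType).
Implicit Types (N : nat) (g h : nat -> R) (y : R).

Let clamp (t : R) : R := (`|t| - `|t - 1| + 1) / 2.

Let clamp0 t : t <= 0 -> clamp t = 0.
Proof.
by move=> t0; rewrite /clamp ler0_norm// ler0_norm; [field|lra].
Qed.

Let clamp1 t : 1 <= t -> clamp t = 1.
Proof.
by move=> t1; rewrite /clamp ger0_norm ?ger0_norm; [field|lra|lra].
Qed.

Let clampid t : 0 <= t <= 1 -> clamp t = t.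
Proof.
by move=> /andP[t0 t1]; rewrite /clamp ger0_norm// ler0_norm; [field|lra].
Qed.

Let clamp_le1 t : `|clamp t| <= 1.
Proof.
have [t0|t0] := leP t 0; first by rewrite clamp0// normr0.
have [t1|t1] := leP t 1; last by rewrite clamp1 ?normr1// ltW.
by rewrite clampid ?(ltW t0)// gtr0_norm.
Qed.

Let lin_interpE N g y : 0 <= y <= 1 -> lin_interp N g y =
  g 0%N + \sum_(i < N) (g i.+1 - g i) * clamp (y * N%:R - i%:R).
Proof.
move=> /andP[y0 y1]; rewrite /lin_interp.
set t := y * N%:R; have t0 : 0 <= t by rewrite mulr_ge0.
have tN : t <= N%:R by rewrite ler_piMl.
have /andP[jt tj] := truncn_itv t0; move: jt tj; set j := Num.truncn t.
move=> jt tj.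
have jN : (j <= N)%N by rewrite -(ler_nat R) (le_trans jt).
rewrite -(big_mkord xpredT (fun i => (g i.+1 - g i) * clamp (t - i%:R))).
rewrite (big_cat_nat (n := j))//=.
rewrite (eq_big_nat _ _ (F2 := fun i => g i.+1 - g i)); last first.
  move=> i /andP[_ ij]; rewrite clamp1 ?mulr1//.
  have : (i.+1%:R : R) <= j%:R by rewrite ler_nat.
  by rewrite -natr1; lra.
rewrite telescope_sumr// addrA (addrC (g 0%N)) subrK; congr (_ + _).
have [jN'|Nj] := ltnP j N; last first.
  have -> : j = N by apply/eqP; rewrite eqn_leq jN.
  rewrite big_geq//.
  have -> : t = N%:R.
    by apply/eqP; rewrite eq_le tN (le_trans _ jt)// ler_nat.
  by rewrite subrr mul0r.
rewrite big_ltn// clampid; last by move: jt tj; rewrite -natr1; lra.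
rewrite big1_seq ?addr0 1?mulrC// => i /andP[_].
rewrite mem_index_iota => /andP[ji _]; rewrite clamp0 ?mulr0//.
have : (j.+1%:R : R) <= i%:R by rewrite ler_nat.
lra.
Qed.

Let clamp_continuous : continuous clamp.
Proof.
move=> t; rewrite /clamp.
apply: cvgMr_tmp; apply: cvgD; last exact: cvg_cst.
apply: cvgB; apply: cvg_norm; first exact: cvg_id.
by apply: cvgB; [exact: cvg_id|exact: cvg_cst].
Qed.

Let clamp_shift_continuous (a b : R) :
  continuous (fun y : R => clamp (y * a - b)).
Proof.
move=> y; apply: (@continuous_comp _ _ _ (fun y : R => y * a - b) clamp).
  by apply: cvgB; [apply: cvgMr_tmp; exact: cvg_id|exact: cvg_cst].
exact: clamp_continuous.
Qed.

Lemma lin_interp_continuous N g :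
  continuous (fun y : unit_interval R => lin_interp N g (\val y)).
Proof.
have -> : (fun y : unit_interval R => lin_interp N g (\val y)) =
    (fun y => g 0%N + \sum_(i < N) (g i.+1 - g i) * clamp (y * N%:R - i%:R))
    \o (\val : unit_interval R -> R).
  apply/funext => -[y yP] /=; apply: lin_interpE.
  by move/set_mem: (yP); rewrite /= in_itv.
move=> y; apply: continuous_comp; first exact: initial_continuous.
apply: cvgD; first exact: cvg_cst.
move: (N%:R) => a; elim: N => [|N IHN].
  by under eq_fun do rewrite big_ord0; rewrite big_ord0; exact: cvg_cst.
under eq_fun do rewrite big_ord_recr/=; rewrite big_ord_recr/=.
apply: cvgD; first exact: IHN.
by apply: cvgMl_tmp; exact: clamp_shift_continuous.
Qed.

Lemma lin_interp_dist N g h (r : R) y : 0 <= y <= 1 ->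
  (forall j, (j <= N)%N -> `|g j - h j| < r) ->
  `|lin_interp N g y - lin_interp N h y| < r *+ (N.*2.+1).
Proof.
move=> y01 gh; rewrite !lin_interpE// opprD addrACA -sumrB mulrS.
apply: (le_lt_trans (ler_normD _ _)); apply: ltr_leD; first exact: gh.
apply: (le_trans (ler_norm_sum _ _ _)).
have -> : r *+ N.*2 = \sum_(i < N) r *+ 2.
  by rewrite sumr_const card_ord -mulrnA mul2n.
apply: ler_sum => i _.
rewrite -mulrBl normrM.
apply: (le_trans (ler_piMr _ (clamp_le1 _))) => //.
have -> : g i.+1 - g i - (h i.+1 - h i) = (g i.+1 - h i.+1) - (g i - h i).
  by ring.
apply: (le_trans (ler_normB _ _)); rewrite mulr2n; apply: lerD; apply: ltW.
  exact: gh.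
by apply: gh; exact: ltnW.
Qed.

End lin_interp_theory.

Lemma pyramid_continuous (R : realType) (v : nat -> nat -> R) (m : nat) :
  continuous (fun y : unit_interval R => pyramid v m (\val y)).
Proof.
case: m => [|m]; last exact: lin_interp_continuous.
by move=> y; exact: initial_continuous.
Qed.

Definition pyramid_path (R : realType) (v : nat -> nat -> R) (m : nat) : C01 R :=
  mkcts (@pyramid_continuous R v m).

Section pyramid_measurable.
Context (R : realType) (d : measure_display) (T : measurableType d).

Lemma measurable_lin_interp (N : nat) (G : T -> nat -> R) (y : R) :
  (forall j, measurable_fun setT (fun w => G w j)) ->
  measurable_fun setT (fun w => lin_interp N (G w) y).
Proof.
move=> mG; apply: measurable_funD => //.
by apply: measurable_funM => //; apply: measurable_funB.
Qed.

Lemma measurable_pyramid (V : nat -> nat -> T -> R) (m : nat) (y : R) :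
  (forall m j, measurable_fun setT (V m j)) ->
  measurable_fun setT (fun w => pyramid (fun m j => V m j w) m y).
Proof.
move=> mV; elim: m y => [|m IHm] y //=.
apply: measurable_lin_interp => j /=; case: (odd j) => //.
apply: measurable_funD; apply: measurable_funM => //.
exact: measurable_funB.
Qed.

(* A random piecewise linear function with fixed nodes and measurable values at
   the nodes is Borel measurable: the nodal values can be approximated by
   rationals. *)
Lemma measurable_lin_interp_path (N : nat) (G : T -> nat -> R) (X : T -> C01 R) :
  (forall j, measurable_fun setT (fun w => G w j)) ->
  (forall w y, X w y = lin_interp N (G w) (\val y)) ->
  measurable_fun setT X.
Proof.
move=> mG XE; apply: (measurability (@open (C01 R))) => // _ [U oU <-].
rewrite setTI.
pose grid (q : {ffun 'I_N.+1 -> rat}) (j : nat) : R := ratr (q (inord j)).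
pose phi q : C01 R := mkcts (@lin_interp_continuous R N (grid q)).
pose M : R := (N.*2.+1)%:R.
have M0 : 0 < M by rewrite ltr0n.
pose D (p : {ffun 'I_N.+1 -> rat} * nat) : set T :=
  [set w | ball (phi p.1) (p.2.+1%:R^-1) `<=` U /\
           forall j : 'I_N.+1, `|G w j - grid p.1 j| < p.2.+1%:R^-1 / M].
have near_phi w q n : (forall j : 'I_N.+1, `|G w j - grid q j| < n.+1%:R^-1 / M) ->
    forall y, `|X w y - phi q y| < n.+1%:R^-1.
  move=> h y; rewrite XE /phi /=.
  have /set_mem := valP y; rewrite /= in_itv/= => y01.
  have -> : (n.+1%:R^-1 : R) = (n.+1%:R^-1 / M) *+ (N.*2.+1).
    by rewrite -[RHS]mulr_natr mulfVK// gt_eqF.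
  apply: lin_interp_dist => // j jN.
  by have := h (Ordinal (jN : (j < N.+1)%N)).
have -> : X @^-1` U = \bigcup_p D p.
  apply/seteqP; split => w /=; last first.
    move=> [[q n] _ [/= sU h]]; apply: sU; apply/C01_ballE => y.
    by rewrite distrC; exact: near_phi.
  move=> UX; have : nbhs (X w) U by exact: open_nbhs_nbhs.
  rewrite -nbhs_ballE => -[e /= e0 sU].
  have [n ne] : exists n, n.+1%:R^-1 < e / 2.
    have /ltr_add_invr[n] : 0 < e / 2 by rewrite divr_gt0.
    by rewrite add0r => ?; exists n.
  have r0 : 0 < n.+1%:R^-1 / M :> R by rewrite divr_gt0// invr_gt0.
  have /choice[q hq] (j : 'I_N.+1) :
      exists q : rat, `|G w j - ratr q| < n.+1%:R^-1 / M.
    have /rat_in_itvoo[q] : G w j < G w j + n.+1%:R^-1 / M by rewrite ltrDl.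
    rewrite in_itv/= => /andP[q1 q2]; exists q.
    by rewrite distrC ger0_norm ?subr_ge0 ?(ltW q1)// ltrBlDl.
  have hG (j : 'I_N.+1) : `|G w j - grid (finfun q) j| < n.+1%:R^-1 / M.
    by rewrite /grid ffunE inord_val.
  exists (finfun q, n) => //; split => //= f /C01_ballE fq.
  apply: sU; apply/C01_ballE => y.
  rewrite (splitr e); apply: (le_lt_trans (ler_distD (phi (finfun q) y) _ _)).
  apply: ltrD; apply: (lt_trans _ ne); first exact: near_phi.
  exact: fq.
apply: countable_bigcupT_measurable => [|[q n]]; first exact: countableP.
rewrite /D /=; have [sU|sU] := pselect (ball (phi q) n.+1%:R^-1 `<=` U); last first.
  rewrite (_ : [set _ | _] = set0)//; apply/seteqP; split => // w /= [].
  by [].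
rewrite (_ : [set _ | _] = \bigcap_(j in [set: 'I_N.+1])
    ((fun w => `|G w j - grid q j|) @^-1` `]-oo, (n.+1%:R^-1 / M)[)); last first.
  apply/seteqP; split => w /=.
    by move=> [_ h] j _ /=; rewrite in_itv/=; exact: h.
  by move=> h; split => // j; have := h j I; rewrite /= in_itv.
apply: fin_bigcap_measurable => // j _; rewrite -[X in measurable X]setTI.
suff : measurable_fun setT (fun w => `|G w j - grid q j|) by apply.
by apply: measurableT_comp => //; exact: measurable_funB.
Qed.

Lemma measurable_pyramid_path (V : nat -> nat -> T -> R) (m : nat) :
  (forall m j, measurable_fun setT (V m j)) ->
  measurable_fun setT (fun w => pyramid_path (fun m j => V m j w) m).
Proof.
move=> mV; case: m => [|m].
  rewrite (_ : (fun _ => _) = cst (pyramid_path (fun _ _ => 0) 0)).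
    exact: measurable_cst.
  by apply/funext => w; apply/continuousEP.
apply: (@measurable_lin_interp_path (2 ^ m.+1) (fun w j =>
  if odd j then
    pyramid (fun m j => V m j w) m (j.-1%:R / (2 ^ m.+1)%:R) * (1 - V m.+1 j w)
    + pyramid (fun m j => V m j w) m (j.+1%:R / (2 ^ m.+1)%:R) * V m.+1 j w
  else pyramid (fun m j => V m j w) m (j%:R / (2 ^ m.+1)%:R))) => // j /=.
case: (odd j); last exact: measurable_pyramid.
apply: measurable_funD; apply: measurable_funM => //.
- exact: measurable_pyramid.
- exact: measurable_funB.
- exact: measurable_pyramid.
Qed.

End pyramid_measurable.

Section random_pyramid.
Context (R : realType) (d : measure_display) (T : measurableType d).
Variables (P : probability T R) (V : nat -> nat -> {RV P >-> R}) (m : nat).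

Definition random_pyramid (w : T) : C01 R :=
  pyramid_path (fun m j => V m j w) m.

Let measurable_random_pyramid : measurable_fun setT random_pyramid.
Proof. by apply: measurable_pyramid_path => m' j; exact: measurable_funP. Qed.

HB.instance Definition _ :=
  isMeasurableFun.Build _ _ _ _ random_pyramid measurable_random_pyramid.

Definition max_increment (w : T) : R :=
  let Q := pyramid (fun m j => V m j w) m in
  \big[Num.max/0]_(1 <= j < (2 ^ m).+1)
    (Q (j%:R / (2 ^ m)%:R) - Q (j.-1%:R / (2 ^ m)%:R)).

End random_pyramid.

Section probability_notions.
Context (R : realType) (d : measure_display) (T : measurableType d).
Variable (P : probability T R).

(* f is a version of the conditional probability P(A | G) *)
Definition is_cond_prob (G : set (set T)) (A : set T) (f : T -> R) : Prop :=
  [/\ forall B : set R, measurable B -> G (f @^-1` B),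
      P.-integrable setT (EFin \o f) &
      forall B, G B -> (\int[P]_(x in B) (f x)%:E = P (A `&` B))%E].

(* Versions of a conditional probability exist and are a.s. unique, so the
   choice of the versions f j is irrelevant. Taking B j = setT for some of the
   j covers the subfamilies. *)
Definition cond_independent (G : set (set T)) (J : finType) (X : J -> T -> R) :
    Prop :=
  forall B : J -> set R, (forall j, measurable (B j)) ->
  exists f : J -> T -> R,
    (forall j, is_cond_prob G (X j @^-1` B j) (f j)) /\
    is_cond_prob G (\bigcap_(j in [set: J]) (X j @^-1` B j))
      (fun x => \prod_j f j x).

Definition earlier_levels (V : nat -> nat -> T -> R) (m : nat) : set (set T) :=
  <<s [set A | exists m' j (B : set R),
         [/\ (0 < m' < m)%N, odd j, (j < 2 ^ m')%N, measurable B &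
             A = V m' j @^-1` B]] >>.

(* k |-> k.*2.+1 enumerates the odd numbers below 2 ^ m for k < 2 ^ m.-1. *)
Definition pyramid_variables (V : nat -> nat -> {RV P >-> R}) : Prop :=
  (forall m j w, (0 < m)%N -> odd j -> (j < 2 ^ m)%N -> 0 <= V m j w <= 1) /\
  (forall m, (0 < m)%N ->
     cond_independent (earlier_levels V m)
       (fun k : 'I_(2 ^ m.-1) => V m k.*2.+1)).

Definition cvg_in_probability (X_ : nat -> T -> R) (X : T -> R) : Prop :=
  forall e : R, 0 < e -> P [set w | e < `|X_ n w - X w|] @[n --> \oo] --> 0%E.

End probability_notions.

Definition cvg_in_distribution (R : realType)
    (d : measure_display) (T : measurableType d) (P : probability T R)
    (d' : measure_display) (T' : measurableType d') (P' : probability T' R)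
    (X_ : nat -> {RV P >-> C01 R}) (X : {RV P' >-> C01 R}) : Prop :=
  forall F : C01 R -> R, continuous F ->
  (exists M : R, forall f, `|F f| <= M) ->
  ('E_P[F \o X_ n])%E @[n --> \oo] --> ('E_P'[F \o X])%E.

(* Main.v *)
(** The paths of the pyramid are nondecreasing, and for n >= m the path Q_n agrees
    with Q_m at the nodes i / 2 ^ m; hence |Q_n - Q_m| <= Delta_m everywhere.
    Convergence in probability forces inf_m Delta_m = 0 almost surely, and where
    this holds (Q_n) is uniformly Cauchy.  Taking the uniform limit there, and the
    identity path on the null complement, gives Q on the original probability
    space; almost sure uniform convergence implies convergence in distribution. *)
Require Import Defs.
From HB Require Import structures.
From mathcomp Require Import all_boot all_order all_algebra.
From mathcomp Require Import all_classical all_reals all_analysis.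
From mathcomp Require Import measurable_realfun lra zify.

Import Order.TTheory GRing.Theory Num.Theory.
Import numFieldNormedType.Exports.

Local Open Scope classical_set_scope.
Local Open Scope ring_scope.

(** * Monotonicity and refinement of a deterministic pyramid *)

Section pyramid_nodes.
Context {R : realType}.
Implicit Types (v : nat -> nat -> R) (g : nat -> R) (y z : R).

(** The constraint on one realization of the variables: everything up to the existence of the limit
    path is proved realization by realization. *)
Definition admissible v := forall m j,
  (0 < m)%N -> odd j -> (j < 2 ^ m)%N -> 0 <= v m j <= 1.

(** When [j = N] the value [g N.+1] is unconstrained but gets weight 0, so the upper bound is
    restricted to [j < N]. *)
Lemma lin_interp_bounds N g y (j := Num.truncn (y * N%:R)) :
  (forall i, (i < N)%N -> g i <= g i.+1) -> 0 <= y <= 1 ->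
  [/\ (j <= N)%N, g j <= lin_interp N g y &
      (j < N)%N -> lin_interp N g y <= g j.+1].
Proof.
move=> gS /andP[y0 y1]; rewrite /lin_interp -/j.
have t0 : 0 <= y * N%:R by rewrite mulr_ge0.
have tN : y * N%:R <= N%:R by rewrite ler_piMl.
have /andP[] := truncn_itv t0; rewrite -/j => jt tj.
have jN : (j <= N)%N by rewrite -(ler_nat R) (le_trans jt).
move: jt tj tN; set t := y * _ => jt tj tN.
split=> //; last first.
  move=> /gS gj; rewrite -natr1 in tj; nra.
move: jN; rewrite leq_eqVlt => /predU1P[jN|/gS gj]; last nra.
have -> : t = j%:R by apply/eqP; rewrite eq_le jt jN tN.
by rewrite subrr mul0r addr0.
Qed.

(** Within one cell the slope is nonnegative; for points in different cells, the right node of the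
    cell of [y] separates the two values. *)
Lemma lin_interp_homo N g :
  (forall i, (i < N)%N -> g i <= g i.+1) ->
  {in `[0, 1] &, {homo lin_interp N g : y z / y <= z}}.
Proof.
move=> gS y z; rewrite !in_itv/= => y01 z01 yz.
have [jN gj Lj] := lin_interp_bounds _ _ _ gS y01.
have [kN gk Lk] := lin_interp_bounds _ _ _ gS z01.
have : (Num.truncn (y * N%:R) <= Num.truncn (z * N%:R))%N.
  by apply: le_truncn; rewrite ler_wpM2r.
rewrite leq_eqVlt => /predU1P[jk|jk].
  rewrite /lin_interp jk; set k := Num.truncn _ in kN *.
  move: kN; rewrite leq_eqVlt => /predU1P[kN|/gS gkS].
    (* Here [k = N] and the sign of [g N.+1 - g N] is unknown, but both arguments are forced to
       equal [N], so the two interpolated values coincide. *)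
    have zN : z * N%:R = k%:R.
      apply/eqP; rewrite eq_le {2}/k truncn_le ?mulr_ge0 ?(andP z01).1// andbT.
      by rewrite kN ler_piMl// (andP z01).2.
    have yN : y * N%:R = k%:R.
      apply/eqP; rewrite eq_le {2}/k -jk truncn_le ?mulr_ge0 ?(andP y01).1// andbT.
      by rewrite kN ler_piMl// (andP y01).2.
    by rewrite yN zN.
  by rewrite lerD2l ler_wpM2r ?subr_ge0// lerD2r ler_wpM2r.
have le_g i k : (i <= k)%N -> (k <= N)%N -> g i <= g k.
  elim: k => [|k IHk]; first by rewrite leqn0 => /eqP->.
  rewrite leq_eqVlt => /predU1P[->//|ik] kN'.
  exact: le_trans (IHk ik (ltnW kN')) (gS _ kN').
apply: (le_trans (Lj (leq_trans jk kN))).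
exact: le_trans (le_g _ _ jk kN) gk.
Qed.

(** Level 0, the identity, is included as interpolation on a single cell, so that [lin_interp_homo]
    applies to every level. *)
Lemma pyramid_lin_interp v m y : 0 <= y <= 1 ->
  pyramid v m y = lin_interp (2 ^ m) (fun j => pyramid v m (j%:R / (2 ^ m)%:R)) y.
Proof.
case: m => [|m] _.
  rewrite /= /lin_interp expn0 mulr1 !divr1 -natr1.
  by rewrite [_ + 1]addrC addrK mulr1 addrC subrK.
congr (lin_interp _ _ _); apply/funext => j.
by rewrite [RHS]lin_interp_node// expn_gt0.
Qed.

Lemma pyramid_even v m i :
  pyramid v m.+1 (i.*2%:R / (2 ^ m.+1)%:R) = pyramid v m (i%:R / (2 ^ m)%:R).
Proof.
rewrite /= lin_interp_node ?expn_gt0// odd_double; congr pyramid.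
by rewrite expnS -mul2n !natrM -mulf_div divff ?mul1r// pnatr_eq0.
Qed.

Lemma pyramid_odd v m i :
  pyramid v m.+1 (i.*2.+1%:R / (2 ^ m.+1)%:R) =
    pyramid v m (i%:R / (2 ^ m)%:R) * (1 - v m.+1 i.*2.+1)
    + pyramid v m (i.+1%:R / (2 ^ m)%:R) * v m.+1 i.*2.+1.
Proof.
have half k : k.*2%:R / (2 ^ m.+1)%:R = k%:R / (2 ^ m)%:R :> R.
  by rewrite expnS -mul2n !natrM -mulf_div divff ?mul1r// pnatr_eq0.
rewrite [LHS]/= lin_interp_node ?expn_gt0//= odd_double/=.
by rewrite half -doubleS half.
Qed.

Lemma pyramid_refine v m n i : (m <= n)%N ->
  pyramid v n (i%:R / (2 ^ m)%:R) = pyramid v m (i%:R / (2 ^ m)%:R).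
Proof.
move=> /subnK <-; elim: (n - m)%N => [//|k IHk]; rewrite addSn -IHk.
(* As a node of level [k + m], the point becomes an even node of the next level, where the value is
   inherited. *)
have -> : i%:R / (2 ^ m)%:R = (i * 2 ^ k)%:R / (2 ^ (k + m))%:R :> R.
  by rewrite expnD mulnC !natrM -mulf_div divff ?mul1r// pnatr_eq0 expn_eq0.
rewrite -pyramid_even; congr pyramid.
by rewrite expnS -mul2n !natrM -mulf_div divff ?mul1r// pnatr_eq0.
Qed.

Lemma pyramid0 v m : pyramid v m 0 = 0.
Proof. by have := @pyramid_refine v 0 m 0 isT; rewrite /= mul0r. Qed.

Lemma pyramid1 v m : pyramid v m 1 = 1.
Proof. by have := @pyramid_refine v 0 m 1 isT; rewrite /= expn0 divr1. Qed.

(** A new node value is a convex combination of the values at its two neighbours, which are ordered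
    by induction, so it lies between them. *)
Lemma pyramid_node_le v m i : admissible v -> (i < 2 ^ m)%N ->
  pyramid v m (i%:R / (2 ^ m)%:R) <= pyramid v m (i.+1%:R / (2 ^ m)%:R).
Proof.
move=> vP; elim: m i => [|m IHm] i im.
  by rewrite /= ler_wpM2r// ler_nat.
(* Cell [i] of level [m.+1] is one half of cell [k] of level [m]; the parity of [i] tells which
   half. *)
have := odd_double_half i; set k := i./2 => ik.
have km : (k < 2 ^ m)%N by move: im; rewrite expnS -ik; lia.
have : (k.*2.+1 < 2 ^ m.+1)%N by rewrite expnS; lia.
move=> /(vP _ _ (ltn0Sn m)); rewrite oddS odd_double => /(_ isT) v01.
have {IHm} := IHm _ km.
case: (odd i) ik => <-; rewrite ?(add1n, add0n).
  rewrite -doubleS pyramid_even pyramid_odd; nra.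
rewrite pyramid_odd pyramid_even; nra.
Qed.

Lemma pyramid_homo v m : admissible v ->
  {in `[0, 1] &, {homo pyramid v m : y z / y <= z}}.
Proof.
move=> vP y z y01 z01 yz.
rewrite (@pyramid_lin_interp _ _ y)// (@pyramid_lin_interp _ _ z)//.
by apply: lin_interp_homo => // i; exact: pyramid_node_le.
Qed.

(* Both functions are nondecreasing and agree at the nodes i / 2 ^ m. *)
Lemma pyramid_dist v m n (D : R) y : admissible v -> (m <= n)%N -> 0 <= D ->
  (forall i, (i < 2 ^ m)%N ->
     pyramid v m (i.+1%:R / (2 ^ m)%:R) - pyramid v m (i%:R / (2 ^ m)%:R) <= D) ->
  0 <= y <= 1 -> `|pyramid v n y - pyramid v m y| <= D.
Proof.
move=> vP mn D0 incD y01; have /andP[y0 y1] := y01.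
have M0 : 0 < (2 ^ m)%:R :> R by rewrite ltr0n expn_gt0.
have t0 : 0 <= y * (2 ^ m)%:R by rewrite mulr_ge0.
have /andP[] := truncn_itv t0; set j := Num.truncn _ => jt tj.
have jy : j%:R / (2 ^ m)%:R <= y by rewrite ler_pdivrMr.
have [jm|mj] := ltnP j (2 ^ m); last first.
  have -> : y = 1.
    apply/eqP; rewrite eq_le y1 (le_trans _ jy)//.
    by rewrite ler_pdivlMr// mul1r ler_nat.
  by rewrite !pyramid1 subrr normr0.
have yj : y <= j.+1%:R / (2 ^ m)%:R by rewrite ler_pdivlMr// ltW.
have node k : (k <= 2 ^ m)%N -> (k%:R / (2 ^ m)%:R : R) \in `[0, 1].
  by move=> km; rewrite in_itv/= divr_ge0//= ler_pdivrMr// mul1r ler_nat.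
have yI : y \in `[0, 1] by rewrite in_itv.
have hm1 := pyramid_homo _ m vP _ _ (node _ (ltnW jm)) yI jy.
have hm2 := pyramid_homo _ m vP _ _ yI (node _ jm) yj.
have := pyramid_homo _ n vP _ _ (node _ (ltnW jm)) yI jy.
have := pyramid_homo _ n vP _ _ yI (node _ jm) yj.
rewrite !pyramid_refine// => hn2 hn1.
have := incD _ jm; rewrite ler_norml; lra.
Qed.

End pyramid_nodes.

(** * Uniform convergence in C[0,1] and the limit of one pyramid *)

Lemma unit_interval_itv (R : realType) (y : unit_interval R) :
  \val y \in `[(0 : R), 1].
Proof. by have /set_mem := valP y. Qed.

Lemma cvg_C01P (R : realType) (f_ : nat -> C01 R) (f : C01 R) :
  f_ n @[n --> \oo] --> f <->
  forall e : R, 0 < e -> \forall n \near \oo, forall y, `|f y - f_ n y| < e.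
Proof.
split=> [/cvg_ballP h e e0|h].
  by apply: filterS (h e e0) => n /C01_ballE.
apply/cvg_ballP => e e0.
by apply: filterS (h e e0) => n ?; apply/C01_ballE.
Qed.

Lemma cvg_C01_eval (R : realType) (f_ : nat -> C01 R) (f : C01 R) y :
  f_ n @[n --> \oo] --> f -> f_ n y @[n --> \oo] --> f y.
Proof.
move=> /cvg_C01P h; apply/cvgrPdist_lt => e e0.
by apply: filterS (h e e0) => n; apply.
Qed.

(** All three conditions are equalities or weak inequalities between values, hence survive pointwise
    limits. *)
Lemma cvg_quantile_function (R : realType) (f_ : nat -> C01 R) (f : C01 R) :
  (forall n, quantile_function (f_ n)) -> f_ n @[n --> \oo] --> f ->
  quantile_function f.
Proof.
move=> qf f_f.
have cvg_cst_eq y (c : R) : (forall n, f_ n y = c) -> f y = c.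
  move=> fc; have := cvg_C01_eval _ _ _ y f_f.
  under eq_fun do rewrite fc.
  by move=> /cvg_lim <-//; rewrite lim_cst.
split=> [y y0|y y1|y z yz].
- by apply: cvg_cst_eq => n; have [+ _ _] := qf n; exact.
- by apply: cvg_cst_eq => n; have [_ + _] := qf n; exact.
- apply: (ler_cvg_to (cvg_C01_eval _ _ _ y f_f) (cvg_C01_eval _ _ _ z f_f)).
  by apply: nearW => n; have [_ _] := qf n; exact.
Qed.

Section pyramid_limit.
Context {R : realType}.
Variable v : nat -> nat -> R.
Hypothesis vP : admissible v.

Lemma pyramid_path_quantile m : quantile_function (pyramid_path v m).
Proof.
split=> [y y0|y y1|y z yz].
- by rewrite -[LHS]/(pyramid v m (\val y)) y0 pyramid0.
- by rewrite -[LHS]/(pyramid v m (\val y)) y1 pyramid1.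
- by apply: pyramid_homo => //; exact: unit_interval_itv.
Qed.

(** One good level [m] per [e] suffices, since [pyramid_dist] controls all levels [n >= m] at
    once. *)
Lemma pyramid_path_cvg :
  (forall e : R, 0 < e -> exists m, forall i, (i < 2 ^ m)%N ->
    pyramid v m (i.+1%:R / (2 ^ m)%:R) - pyramid v m (i%:R / (2 ^ m)%:R) <= e) ->
  exists f : C01 R,
    quantile_function f /\ pyramid_path v n @[n --> \oo] --> f.
Proof.
move=> small.
(* Completeness is applied in the space of all functions with the uniform structure; continuity of
   the limit is recovered afterwards. *)
have : cauchy (C01_fun (pyramid_path v n) @[n --> \oo]).
  apply: cauchy_exP => e e0.
  (* Halving turns the weak bound of [pyramid_dist] into the strict one required by the ball. *)
  have e20 : 0 < e / 2 by rewrite divr_gt0.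
  have [m hm] := small _ e20.
  exists (C01_fun (pyramid_path v m)); exists m => // n /= mn y.
  rewrite /ball/= distrC; apply: (@le_lt_trans _ _ (e / 2)); last first.
    by rewrite gtr_pMr// invf_lt1// ltr1n.
  apply: pyramid_dist => //; first exact: ltW.
  by have := unit_interval_itv _ y; rewrite in_itv.
move=> /cauchy_cvgP /cvg_ex[/= f f_cvg].
have cf : continuous (f : unit_interval R -> R).
  apply: (@uniform_limit_continuous _ _
    ((pyramid_path v n : unit_interval R -> R) @[n --> \oo])).
    by exists 0%N => // n _; exact: pyramid_continuous.
  move=> B /uniform_nbhs[E [+ EB]].
  rewrite -entourage_ballE => -[e /= e0 eE].
  move/cvg_ballP : f_cvg => /(_ e e0); apply: filterS => n fn.
  by apply: EB => y _; apply: eE; exact: fn.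
suff fcvg : pyramid_path v n @[n --> \oo] --> (mkcts cf : C01 R).
  exists (mkcts cf); split=> //; apply: cvg_quantile_function fcvg => n.
  exact: pyramid_path_quantile.
apply/cvg_C01P => e e0.
by move/cvg_ballP : f_cvg => /(_ e e0); apply: filterS => n.
Qed.

End pyramid_limit.

(** * Borel measurability in C[0,1] *)

Section borel.
Context {R : realType} {d : measure_display} {T : measurableType d}.

Lemma continuous_measurable_C01 (F : C01 R -> R) :
  continuous F -> measurable_fun setT F.
Proof.
move=> cF; apply: (measurability _ (RGenOpens.measurableE R)).
move=> _ [_ [a [b ->]] <-]; rewrite setTI; apply: sub_sigma_algebra.
by apply: open_comp; [move=> ? _; exact: cF|exact: interval_open].
Qed.

(* The limit lies in the open set U iff, for some k, eventually the sequence
   avoids the open 1/k-neighbourhood of the complement of U. *)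
Lemma measurable_fun_cvg_C01 (D : set T) (X_ : nat -> T -> C01 R)
    (X : T -> C01 R) :
  measurable D -> (forall n, measurable_fun D (X_ n)) ->
  (forall w, D w -> X_ n w @[n --> \oo] --> X w) -> measurable_fun D X.
Proof.
move=> mD mX X_X; apply: (measurability (@open (C01 R))) => // _ [U oU <-].
(* Taking interiors makes [G k] a union of open sets, hence Borel. *)
pose G (k : nat) : set (C01 R) := \bigcup_(g in ~` U) (ball g k.+1%:R^-1)^°.
have oG k : open (G k) by apply: bigcup_open => g _; exact: open_interior.
suff -> : D `&` X @^-1` U =
    \bigcup_k \bigcup_N \bigcap_(n in [set n | (N <= n)%N])
      (D `&` X_ n @^-1` (~` G k)).
  apply: bigcupT_measurable => k; apply: bigcupT_measurable => N.
  apply: bigcap_measurable; first by exists N => /=.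
  move=> n _; apply: mX => //; apply: measurableC.
  exact: sub_sigma_algebra.
apply/seteqP; split => w /=.
  move=> [Dw]; rewrite openE in oU => /oU; rewrite /interior -nbhs_ballE.
  move=> [e /= e0 eU].
  have e20 : 0 < e / 2 by rewrite divr_gt0.
  have [k _ /(_ k (leqnn k))/= ke] := near_infty_natSinv_lt (PosNum e20).
  have /cvg_ballP /(_ _ e20) [N _ hN] := X_X w Dw.
  exists k => //; exists N => // n /= Nn; split=> // -[g nUg /interior_subset].
  move=> /ball_sym gX; apply/nUg/eU; rewrite (splitr e).
  apply: ball_triangle (hN n Nn) _.
  exact: le_ball (ltW ke) _ gX.
(* Conversely, a limit outside [U] would lie in the open set [G k], and the sequence would
   eventually enter it. *)
move=> [k _ [N _ h]]; have [Dw _] := h N (leqnn N); split=> //.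
apply: contrapT => nU; have GX : G k (X w).
  exists (X w) => //; exact: nbhsx_ballx.
have /(X_X w Dw) [M _ hM] := open_nbhs_nbhs (conj (oG k) GX).
have [_] := h _ (leq_maxl N M); apply; exact: hM (leq_maxr N M).
Qed.

End borel.

(** * Almost surely small increments *)

Section random_pyramid_limit.
Context {R : realType} {d : measure_display} {T : measurableType d}.
Variables (P : probability T R) (V : nat -> nat -> {RV P >-> R}).

Lemma measurable_max_increment m : measurable_fun setT (max_increment V m).
Proof.
rewrite /max_increment; move: (index_iota _ _) => s; elim: s => [|j s IHs].
  by under eq_fun do rewrite big_nil; exact: measurable_cst.
under eq_fun do rewrite big_cons; apply: measurable_maxr => //.
by apply: measurable_funB; exact: measurable_pyramid.
Qed.

Lemma le_max_increment m w i (v := fun m j => V m j w) : (i < 2 ^ m)%N ->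
  pyramid v m (i.+1%:R / (2 ^ m)%:R) - pyramid v m (i%:R / (2 ^ m)%:R)
    <= max_increment V m w.
Proof.
move=> im; rewrite /max_increment.
apply: (bigmax_sup_seq _ i.+1) => //.
by rewrite mem_index_iota ltnS.
Qed.

Lemma measurable_max_increment_le m (e : R) :
  measurable [set w | max_increment V m w <= e].
Proof.
rewrite (_ : [set _ | _] = setT `&` max_increment V m @^-1` `]-oo, e]).
  exact: measurable_max_increment.
by apply/seteqP; split => w /=; rewrite in_itv//= => -[].
Qed.

(** For fixed [k], the event that every level exceeds [k.+1%:R^-1] is contained in the tail event of
    each single level, and the probabilities of these tend to 0. *)
Lemma ae_small_increment :
  cvg_in_probability P (max_increment V) (fun _ => 0) ->
  {ae P, forall w, (\bigcap_k \bigcup_m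
    [set w | max_increment V m w <= k.+1%:R^-1]) w}.
Proof.
move=> cvgD; change (P.-negligible (~` (\bigcap_k \bigcup_m
    [set w | max_increment V m w <= k.+1%:R^-1]))).
rewrite setC_bigcap; apply: negligible_bigcup => k.
rewrite setC_bigcup; set B := \bigcap_m _.
have mB : measurable B.
  apply: bigcapT_measurable => m; apply: measurableC.
  exact: measurable_max_increment_le.
exists B; split=> //; apply/eqP; rewrite eq_le measure_ge0 andbT.
have : 0 < (k.+1%:R^-1 : R) by rewrite invr_gt0.
(* The bound on [P B] holds at every level, so it passes to the limit 0. *)
move=> /cvgD; apply: cvge_ge; apply: nearW => m.
apply: le_measure; rewrite ?inE//.
  rewrite (_ : [set _ | _] = setT `&` (fun w => `|max_increment V m w - 0|) @^-1`
      `]k.+1%:R^-1, +oo[); last first.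
    by apply/seteqP; split => w /=; rewrite in_itv/= ?andbT// => -[].
  suff : measurable_fun setT (fun w => `|max_increment V m w - 0|) by apply.
  apply: measurableT_comp => //; apply: measurable_funB => //.
  exact: measurable_max_increment.
move=> w Bw; have /negP := Bw m I; rewrite -ltNge /= subr0 => /lt_le_trans; apply.
exact: ler_norm.
Qed.

End random_pyramid_limit.

(** * Bounded convergence and the limit process *)

Lemma expectation_cvg_bounded (R : realType) (d : measure_display)
    (T : measurableType d) (P : probability T R) (F_ : nat -> T -> R)
    (F : T -> R) (M : R) :
  (forall n, measurable_fun setT (F_ n)) -> measurable_fun setT F ->
  (forall n w, `|F_ n w| <= M) ->
  {ae P, forall w, F_ n w @[n --> \oo] --> F w} ->
  ('E_P[F_ n])%E @[n --> \oo] --> ('E_P[F])%E.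
Proof.
move=> mF_ mF leM cvgF; rewrite unlock.
have iM : P.-integrable setT (EFin \o cst M).
  exact: finite_measure_integrable_cst.
have [] := dominated_convergence measurableT
  (f_ := fun n w => (F_ n w)%:E) (f := fun w => (F w)%:E) _ _ _ iM _.
- by move=> n; apply/measurable_EFinP.
- exact/measurable_EFinP.
- by apply: filterS cvgF => w h _; apply: cvg_EFin => //; exact: nearW.
- by apply: aeW => w n _; rewrite lee_fin.
- by [].
Qed.

Theorem proposition2p1 (R : realType) (d : measure_display)
    (T : measurableType d) (P : probability T R)
    (V : nat -> nat -> {RV P >-> R}) :
  pyramid_variables V ->
  cvg_in_probability P (fun m w => max_increment V m w) (fun _ => 0) ->
  exists (d' : measure_display) (T' : measurableType d')
         (P' : probability T' R) (Q : {RV P' >-> C01 R}),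
    (forall w, quantile_function (Q w)) /\
    cvg_in_distribution (fun m => random_pyramid V m : {RV P >-> C01 R}) Q.
Proof.
move=> [V01 _] /ae_small_increment.
set A := \bigcap_k _ => aeA.
have mA : measurable A.
  apply: bigcapT_measurable => k; apply: bigcupT_measurable => m.
  exact: measurable_max_increment_le.
have vP w : admissible (fun m j => V m j w) by move=> m j m0 oj jm; exact: V01.
(* Choice gives no measurability by itself: the last clause prescribes one path, the identity, off
   [A], so that [Q] is constant there. *)
have /choice[Q QP] (w : T) : exists f : C01 R, [/\ quantile_function f,
    A w -> random_pyramid V n w @[n --> \oo] --> f &
    ~ A w -> f = pyramid_path (fun _ _ => 0) 0].
  have [Aw|nAw] := pselect (A w); last first.
    by exists (pyramid_path (fun _ _ => 0) 0).
  have [e e0|f [qf f_f]] := pyramid_path_cvg _ (vP w); last by exists f.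
  have [k _ /(_ k (leqnn k))/= ke] := near_infty_natSinv_lt (PosNum e0).
  have [m _ /= mk] := Aw k I; exists m => i im.
  exact: le_trans (le_max_increment _ _ _ _ _ im) (le_trans mk (ltW ke)).
(* On [A] the map [Q] is a pointwise limit of measurable maps; on the complement it is constant. *)
have mQ : measurable_fun setT Q.
  rewrite -(setUv A); apply/measurable_funU => //; first exact: measurableC.
  split.
    apply: (measurable_fun_cvg_C01 _ (fun n => random_pyramid V n)) => //.
      by move=> n; apply: measurable_funTS.
    by move=> w; have [_ + _] := QP w.
  apply: (eq_measurable_fun (cst (pyramid_path (fun _ _ => 0) 0))) => //.
  by move=> w; rewrite inE => nAw; have [_ _ ->] := QP w.
pose mQm := isMeasurableFun.Build _ _ _ _ Q mQ.
pose QRV : {RV P >-> C01 R} := HB.pack Q mQm.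
exists d, T, P, QRV; split=> [w|F cF [M FM]]; first by have [] := QP w.
have mF := continuous_measurable_C01 _ cF.
apply: (expectation_cvg_bounded _ _ _ _ _ _ M) => //.
- by move=> n; exact: measurableT_comp.
- exact: measurableT_comp.
- by move=> n w; exact: FM.
- apply: filterS aeA => w Aw; have [_ /(_ Aw) cvgQ _] := QP w.
  exact: (continuous_cvg _ (cF _) cvgQ).
Qed.
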